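(* Every isotropic Berwald twisted product Finsler manifold $(M_1\times_fM_2,F)$ is a Berwald manifold.
   Context: Let $(M_1,F_1)$, $(M_2,F_2)$ be Finsler manifolds (metrics smooth on the slit tangent bundle, positively 1-homogeneous on fibres, with positive definite fundamental tensor) and $f:M_1\times M_2\to\mathbb{R}^+$ smooth. The twisted product $M_1\times_f M_2$ is $M=M_1\times M_2$ with $F=\sqrt{F_1^2(x,y)+f^2(x,u)F_2^2(u,v)}$, considered where $y\in T_xM_1$, $v\in T_uM_2$ are both nonzero. For a Finsler metric $F$ on a manifold $M$ with local coordinates $x^i$ and fibre coordinates $y^i$, $g_{ij}=\frac12(F^2)_{y^iy^j}$, the spray coefficients are $G^i=\frac14g^{il}\big(\frac{\partial^2F^2}{\partial x^k\partial y^l}y^k-\frac{\partial F^2}{\partial x^l}\big)$ and the Berwald curvature is $B^i_{\ jkl}=\frac{\partial^3G^i}{\partial y^j\partial y^k\partial y^l}$. $F$ is a Berwald metric if $B^i_{\ jkl}=0$. $F$ is an isotropic Berwald metric if $$B^i_{\ jkl}=c\{F_{y^jy^k}\delta^i_{\ l}+F_{y^ky^l}\delta^i_{\ j}+F_{y^ly^j}\delta^i_{\ k}+F_{y^jy^ky^l}y^i\}$$ for some scalar function $c=c(x)$ on $M$. *)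

(* Defs.v *)
From HB Require Import structures.
From mathcomp Require Import all_boot all_order all_algebra.
From mathcomp Require Import all_classical all_reals all_analysis.

Set Implicit Arguments.
Unset Strict Implicit.
Unset Printing Implicit Defensive.

Import Order.TTheory GRing.Theory Num.Theory.
Import numFieldNormedType.Exports.

Local Open Scope classical_set_scope.
Local Open Scope ring_scope.

Section Euclidean.
Context {R : realType} {n : nat}.

Definition pd (k : 'I_n) (h : 'rV[R]_n -> R) : 'rV[R]_n -> R :=
  fun x => 'D_(delta_mx 0 k) h x.

Definition iterated_pd (s : seq 'I_n) (h : 'rV[R]_n -> R) : 'rV[R]_n -> R :=
  foldr pd h s.

(* C^oo on U (only used for open U): all iterated partial derivatives exist
   and are continuous at every point of U. *)
Definition smooth_on (U : set 'rV[R]_n) (h : 'rV[R]_n -> R) : Prop :=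
  forall s x, U x -> {for x, continuous (iterated_pd s h)} /\
                     forall k, derivable (iterated_pd s h) x (delta_mx 0 k).

(* The (k, l) entry is d(t^l)/d(x^k): the differential of t sends the row of
   components y to y *m jacobi t x. *)
Definition jacobi (t : 'rV[R]_n -> 'rV[R]_n) (x : 'rV[R]_n) : 'M[R]_n :=
  \matrix_(k, l) pd k (fun z => t z 0 l) x.

End Euclidean.

Record chart (R : realType) (n : nat) (T : topologicalType) := Chart {
  dom : set T;
  coord : T -> 'rV[R]_n;
  param : 'rV[R]_n -> T }.

Section Chart.
Context {R : realType} {n : nat} {T : topologicalType}.
Implicit Types c d : chart R n T.

Definition codom_chart c : set 'rV[R]_n := coord c @` dom c.

(* coord is a homeomorphism from an open set of T onto an open set of R^n, with
   inverse param; values outside dom and codom_chart are irrelevant. *)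
Record is_chart c : Prop := IsChart {
  open_dom : open (dom c);
  open_codom : open (codom_chart c);
  coordK : forall p, dom c p -> param c (coord c p) = p;
  coord_cont : forall p, dom c p -> {for p, continuous (coord c)};
  param_cont : forall x, codom_chart c x -> {for x, continuous (param c)} }.

Definition transition c d : 'rV[R]_n -> 'rV[R]_n := coord d \o param c.

Definition smooth_compatible c d : Prop :=
  forall l, smooth_on (coord c @` (dom c `&` dom d))
                      (fun x => transition c d x 0 l).

End Chart.

Record manifold (R : realType) (n : nat) := Manifold {
  point_of :> topologicalType;
  index : Type;
  chart_at : index -> chart R n point_of;
  manifold_hausdorff : hausdorff_space point_of;
  manifold_second_countable : @second_countable point_of;
  manifold_chart : forall i, is_chart (chart_at i);
  manifold_cover : forall p, exists i, dom (chart_at i) p;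
  manifold_smooth : forall i j, smooth_compatible (chart_at i) (chart_at j) }.

(* A real function on the tangent bundle TM.  TM is glued from the pieces
   dom i x R^n, the triple (i, p, y) being the tangent vector at p with
   components y in the chart i; a function on TM is thus a function of such
   triples that is invariant under the change of components
   y^l |-> (d xbar^l / d x^k) y^k. *)
Record tangent_fun (R : realType) (n : nat) (M : manifold R n) := TangentFun {
  tangent_val :> index M -> M -> 'rV[R]_n -> R;
  tangent_val_compat : forall i j p y,
    dom (chart_at i) p -> dom (chart_at j) p ->
    tangent_val j p
      (y *m jacobi (transition (chart_at i) (chart_at j)) (coord (chart_at i) p))
    = tangent_val i p y }.

Section Manifold.
Context {R : realType} {n : nat} {M : manifold R n}.

Definition smooth_fun (f : M -> R) : Prop :=
  forall i : index M,
    smooth_on (codom_chart (chart_at i)) (f \o param (chart_at i)).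

Definition local_expr (F : tangent_fun M) (i : index M)
    (x y : 'rV[R]_n) : R :=
  F i (param (chart_at i) x) y.

End Manifold.

Section LocalFormulas.
Context {R : realType} {n : nat}.
Variable L : 'rV[R]_n -> 'rV[R]_n -> R.

Definition energy (x y : 'rV[R]_n) : R := L x y ^+ 2.

Definition fundamental_tensor (x y : 'rV[R]_n) : 'M[R]_n :=
  \matrix_(i, j) (2^-1 * pd i (pd j (energy x)) y).

Definition spray (x y : 'rV[R]_n) (i : 'I_n) : R :=
  4^-1 * \sum_(l < n) invmx (fundamental_tensor x y) i l *
    (\sum_(k < n) pd k (fun x' => pd l (energy x') y) x * y 0 k
     - pd l (fun x' => energy x' y) x).

Definition berwald_curvature (x y : 'rV[R]_n) (i j k l : 'I_n) : R :=
  pd j (pd k (pd l (fun y' => spray x y' i))) y.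

Definition isotropic_berwald_tensor (x y : 'rV[R]_n) (i j k l : 'I_n) : R :=
  pd j (pd k (L x)) y * (i == l)%:R
  + pd k (pd l (L x)) y * (i == j)%:R
  + pd l (pd j (L x)) y * (i == k)%:R
  + pd j (pd k (pd l (L x))) y * y 0 i.

End LocalFormulas.

Section Finsler.
Context {R : realType} {n : nat} {M : manifold R n}.

(* The slit tangent space of R^n restricted to U, inside R^(n + n). *)
Definition slit (U : set 'rV[R]_n) : set 'rV[R]_(n + n) :=
  [set z | U (lsubmx z) /\ rsubmx z != 0].

Record finsler (F : tangent_fun M) : Prop := IsFinsler {
  finsler_ge0 : forall i p y, dom (chart_at i) p -> 0 <= F i p y;
  finsler_smooth : forall i,
    smooth_on (slit (codom_chart (chart_at i)))
              (fun z => local_expr F i (lsubmx z) (rsubmx z));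
  finsler_homog : forall i p y (a : R),
    dom (chart_at i) p -> 0 < a -> F i p (a *: y) = a * F i p y;
  finsler_posdef : forall i x y (w : 'rV[R]_n),
    codom_chart (chart_at i) x -> y != 0 -> w != 0 ->
    0 < \sum_(j < n) \sum_(k < n)
          fundamental_tensor (local_expr F i) x y j k * w 0 j * w 0 k }.

(* The metric may be defined only on a part A of the tangent bundle: A i p is
   the set of components, in the chart i, of the vectors of A at p. *)
Definition berwald (A : index M -> M -> set 'rV[R]_n)
    (F : tangent_fun M) : Prop :=
  forall i p y, dom (chart_at i) p -> A i p y ->
  forall a j k l,
    berwald_curvature (local_expr F i) (coord (chart_at i) p) y a j k l = 0.

Definition isotropic_berwald (A : index M -> M -> set 'rV[R]_n)
    (F : tangent_fun M) : Prop :=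
  exists c : M -> R,
  forall i p y, dom (chart_at i) p -> A i p y ->
  forall a j k l,
    berwald_curvature (local_expr F i) (coord (chart_at i) p) y a j k l
    = c p * isotropic_berwald_tensor (local_expr F i)
              (coord (chart_at i) p) y a j k l.

End Finsler.

Section Blocks.
Context {R : realType} {n1 n2 : nat}.

Lemma lsubmx_continuous : continuous (@lsubmx R 1 n1 n2).
Proof.
move=> z A [P zP sPA].
exists (fun i j => if fintype.split j is inl k then P i k else setT) => [i j|w wP].
  case: (split_ordP j) => k ->; last exact: filterT.
  by have := zP i k; rewrite mxE.
apply: sPA => i j; have := wP i (lshift n2 j).
by rewrite mxE; case: (split_ordP (lshift n2 j)) => k;
  [move=> /lshift_inj -> | move=> /eqP; rewrite eq_lrshift].
Qed.

Lemma rsubmx_continuous : continuous (@rsubmx R 1 n1 n2).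
Proof.
move=> z A [P zP sPA].
exists (fun i j => if fintype.split j is inr k then P i k else setT) => [i j|w wP].
  case: (split_ordP j) => k ->; first exact: filterT.
  by have := zP i k; rewrite mxE.
apply: sPA => i j; have := wP i (rshift n1 j).
by rewrite mxE; case: (split_ordP (rshift n1 j)) => k;
  [move=> /eqP; rewrite eq_rlshift | move=> /rshift_inj ->].
Qed.

Lemma row_mx_cvg (T : topologicalType) (g : T -> 'rV[R]_n1)
    (h : T -> 'rV[R]_n2) (p : T) :
  {for p, continuous g} -> {for p, continuous h} ->
  {for p, continuous (fun q => row_mx (g q) (h q))}.
Proof.
move=> cg ch A [P pP sPA].
have Ag : nbhs (g p) [set x | forall i j, P i (lshift n2 j) (x i j)].
  exists (fun i j => P i (lshift n2 j)) => // i j.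
  by have := pP i (lshift n2 j); rewrite row_mxEl.
have Ah : nbhs (h p) [set x | forall i j, P i (rshift n1 j) (x i j)].
  exists (fun i j => P i (rshift n1 j)) => // i j.
  by have := pP i (rshift n1 j); rewrite row_mxEr.
have Bg : nbhs p (g @^-1` _) := cg _ Ag.
have Bh : nbhs p (h @^-1` _) := ch _ Ah.
apply: (filterS _ (filterI Bg Bh)) => q [qg qh]; apply: sPA => i j.
by case: (split_ordP j) => k ->; rewrite ?row_mxEl ?row_mxEr;
  [exact: qg | exact: qh].
Qed.

Lemma lsubmx_delta_l (k : 'I_n1) :
  lsubmx (delta_mx 0 (lshift n2 k) : 'rV[R]_(n1 + n2)) = delta_mx 0 k.
Proof. by apply/rowP => j; rewrite !mxE eq_lshift. Qed.

Lemma lsubmx_delta_r (k : 'I_n2) :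
  lsubmx (delta_mx 0 (rshift n1 k) : 'rV[R]_(n1 + n2)) = 0.
Proof. by apply/rowP => j; rewrite !mxE eq_lrshift andbF. Qed.

Lemma rsubmx_delta_l (k : 'I_n1) :
  rsubmx (delta_mx 0 (lshift n2 k) : 'rV[R]_(n1 + n2)) = 0.
Proof. by apply/rowP => j; rewrite !mxE eq_rlshift andbF. Qed.

Lemma rsubmx_delta_r (k : 'I_n2) :
  rsubmx (delta_mx 0 (rshift n1 k) : 'rV[R]_(n1 + n2)) = delta_mx 0 k.
Proof. by apply/rowP => j; rewrite !mxE eq_rshift. Qed.

Section Compose.
Context {m : nat} (pr : 'rV[R]_(n1 + n2) -> 'rV[R]_m).
Hypothesis prD : forall (a : R) u v, pr (a *: u + v) = a *: pr u + pr v.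

Let quotE (h : 'rV[R]_m -> R) z v :
  (fun e : R => e^-1 *: (((h \o pr) \o shift z) (e *: v) - (h \o pr) z))
  = (fun e : R => e^-1 *: ((h \o shift (pr z)) (e *: pr v) - h (pr z))).
Proof. by apply/funext => e /=; rewrite prD. Qed.

Lemma derive_pr (h : 'rV[R]_m -> R) z v :
  'D_v (h \o pr) z = 'D_(pr v) h (pr z).
Proof. by rewrite /derive quotE. Qed.

Lemma derivable_pr (h : 'rV[R]_m -> R) z v :
  derivable (h \o pr) z v = derivable h (pr z) (pr v).
Proof. by rewrite /derivable quotE. Qed.

Hypothesis pr_cont : continuous pr.
Hypothesis pr_delta : forall k : 'I_(n1 + n2),
  pr (delta_mx 0 k) = 0 \/ exists k', pr (delta_mx 0 k) = delta_mx 0 k'.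

Lemma smooth_on_pr (U : set 'rV[R]_m) (h : 'rV[R]_m -> R) :
  smooth_on U h -> smooth_on (pr @^-1` U) (h \o pr).
Proof.
move=> hU s.
have der0 (z : 'rV[R]_(n1 + n2)) v : derivable (cst 0 : _ -> R) z v.
  exact: derivable_cst.
have [[s' ->]|->] : (exists s', iterated_pd s (h \o pr) = iterated_pd s' h \o pr)
    \/ iterated_pd s (h \o pr) = cst 0.
- elim: s => [|k s [[s' /= ->]|/= ->]].
  + by left; exists [::].
  + have [k0|[k' kk']] := pr_delta k.
      right; apply/funext => z; rewrite /pd derive_pr k0.
      exact: derive0.
    by left; exists (k' :: s'); apply/funext => z; rewrite /pd derive_pr kk'.
  + by right; apply/funext => z; rewrite /pd derive_cst.
- move=> z Uz; have [cz dz] := hU s' _ Uz; split.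
    by apply: continuous_comp; [exact: pr_cont|exact: cz].
  move=> k; rewrite derivable_pr.
  have [->|[k' ->]] := pr_delta k; last exact: dz.
  exact: derivable0.
- by move=> z _; split; [exact: cst_continuous|move=> k; exact: der0].
Qed.

End Compose.
End Blocks.

Section ProductManifold.
Context {R : realType} {n1 n2 : nat}.

Lemma smooth_on_lsubmx (U : set 'rV[R]_n1) (h : 'rV[R]_n1 -> R) :
  smooth_on U h -> smooth_on (@lsubmx R 1 n1 n2 @^-1` U) (h \o lsubmx).
Proof.
apply: smooth_on_pr => [a u v||k]; first by apply/rowP => j; rewrite !mxE.
  exact: lsubmx_continuous.
case: (split_ordP k) => j ->; last by left; rewrite lsubmx_delta_r.
by right; exists j; rewrite lsubmx_delta_l.
Qed.

Lemma smooth_on_rsubmx (U : set 'rV[R]_n2) (h : 'rV[R]_n2 -> R) :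
  smooth_on U h -> smooth_on (@rsubmx R 1 n1 n2 @^-1` U) (h \o rsubmx).
Proof.
apply: smooth_on_pr => [a u v||k]; first by apply/rowP => j; rewrite !mxE.
  exact: rsubmx_continuous.
case: (split_ordP k) => j ->; first by left; rewrite rsubmx_delta_l.
by right; exists j; rewrite rsubmx_delta_r.
Qed.

Lemma smooth_onS n (U V : set 'rV[R]_n) (h : 'rV[R]_n -> R) :
  V `<=` U -> smooth_on U h -> smooth_on V h.
Proof. by move=> VU hU s x /VU; exact: hU. Qed.

Lemma prod_hausdorff (T1 T2 : topologicalType) :
  hausdorff_space T1 -> hausdorff_space T2 -> hausdorff_space (T1 * T2)%type.
Proof.
move=> h1 h2 [p1 p2] [q1 q2] clu; congr pair.
- apply: h1 => A B pA qB.
  have [||[x y] [/= Ax Bx]] := clu (A `*` setT) (B `*` setT).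
  + by exists (A, setT) => //; split=> //; exact: filterT.
  + by exists (B, setT) => //; split=> //; exact: filterT.
  by exists x; split; [case: Ax|case: Bx].
- apply: h2 => A B pA qB.
  have [||[x y] [/= Ax Bx]] := clu (setT `*` A) (setT `*` B).
  + by exists (setT, A) => //; split=> //; exact: filterT.
  + by exists (setT, B) => //; split=> //; exact: filterT.
  by exists y; split; [case: Ax|case: Bx].
Qed.

Lemma open_setX (T1 T2 : topologicalType) (A : set T1) (B : set T2) :
  open A -> open B -> open (A `*` B).
Proof.
rewrite !openE => oA oB [x y] [/= Ax By].
by exists (A, B) => //; split; [exact: oA|exact: oB].
Qed.

Lemma prod_second_countable (T1 T2 : topologicalType) :
  @second_countable T1 -> @second_countable T2 ->
  @second_countable (T1 * T2)%type.
Proof.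
move=> [B1 cB1 [oB1 bB1]] [B2 cB2 [oB2 bB2]].
exists ((fun UV => UV.1 `*` UV.2) @` (B1 `*` B2)).
  exact/(sub_countable (card_image_le _ _))/countableX.
split=> [_ [[U V] [/= /oB1 oU /oB2 oV] <-]|[x y] A [[P Q] [/= xP yQ] sPQA]].
  exact: open_setX.
have [U [BU Ux] UP] := bB1 x P xP; have [V [BV Vy] VQ] := bB2 y Q yQ.
exists (U `*` V); first by split=> //; exists (U, V).
by move=> [a b] [/= /UP Pa /VQ Qb]; apply: sPQA.
Qed.

Definition prod_chart (T1 T2 : topologicalType)
    (c1 : chart R n1 T1) (c2 : chart R n2 T2) :
    chart R (n1 + n2) (T1 * T2)%type :=
  Chart (dom c1 `*` dom c2)
        (fun p => row_mx (coord c1 p.1) (coord c2 p.2))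
        (fun z => (param c1 (lsubmx z), param c2 (rsubmx z))).

Lemma prod_chart_image (T1 T2 : topologicalType)
    (c1 : chart R n1 T1) (c2 : chart R n2 T2) (A : set T1) (B : set T2) :
  coord (prod_chart c1 c2) @` (A `*` B)
  = (lsubmx @^-1` (coord c1 @` A)) `&` (rsubmx @^-1` (coord c2 @` B)).
Proof.
apply/seteqP; split=> [_ [[p q] [/= Ap Bq] <-]|z [[p Ap pz] [q Bq qz]]].
  by split; rewrite /= ?row_mxKl ?row_mxKr; [exists p|exists q].
by exists (p, q) => //=; rewrite pz qz hsubmxK.
Qed.

Lemma prod_is_chart (T1 T2 : topologicalType)
    (c1 : chart R n1 T1) (c2 : chart R n2 T2) :
  is_chart c1 -> is_chart c2 -> is_chart (prod_chart c1 c2).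
Proof.
move=> [od1 oc1 K1 cc1 pc1] [od2 oc2 K2 cc2 pc2]; split.
- exact: open_setX.
- rewrite /codom_chart prod_chart_image; apply: openI.
    by apply: open_comp => // z _; exact: lsubmx_continuous.
  by apply: open_comp => // z _; exact: rsubmx_continuous.
- by move=> [p q] [/= dp dq]; rewrite row_mxKl row_mxKr K1 // K2.
- move=> [p q] [/= dp dq]; apply: row_mx_cvg.
    by apply: continuous_comp; [exact: cvg_fst|exact: cc1].
  by apply: continuous_comp; [exact: cvg_snd|exact: cc2].
- rewrite /codom_chart prod_chart_image => z [/= z1 z2].
  have l : {for z, continuous (param c1 \o lsubmx)}.
    by apply: continuous_comp; [exact: lsubmx_continuous|exact: pc1].
  have r : {for z, continuous (param c2 \o rsubmx)}.
    by apply: continuous_comp; [exact: rsubmx_continuous|exact: pc2].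
  exact: cvg_pair l r.
Qed.

Lemma prod_smooth_compatible (T1 T2 : topologicalType)
    (c1 d1 : chart R n1 T1) (c2 d2 : chart R n2 T2) :
  smooth_compatible c1 d1 -> smooth_compatible c2 d2 ->
  smooth_compatible (prod_chart c1 c2) (prod_chart d1 d2).
Proof.
move=> s1 s2 l; have -> : dom (prod_chart c1 c2) `&` dom (prod_chart d1 d2)
  = (dom c1 `&` dom d1) `*` (dom c2 `&` dom d2).
  by apply/seteqP; split=> [[p q] [[? ?] [? ?]]|[p q] [[? ?] [? ?]]].
rewrite prod_chart_image; case: (split_ordP l) => k ->.
  have -> : (fun x => transition (prod_chart c1 c2) (prod_chart d1 d2) x 0
                        (lshift n2 k))
      = (fun x => transition c1 d1 x 0 k) \o lsubmx.
    by apply/funext => x; rewrite /transition /= row_mxEl.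
  exact: smooth_onS (@subIsetl _ _ _) (smooth_on_lsubmx (s1 k)).
have -> : (fun x => transition (prod_chart c1 c2) (prod_chart d1 d2) x 0
                      (rshift n1 k))
    = (fun x => transition c2 d2 x 0 k) \o rsubmx.
  by apply/funext => x; rewrite /transition /= row_mxEr.
exact: smooth_onS (@subIsetr _ _ _) (smooth_on_rsubmx (s2 k)).
Qed.

Definition prod_manifold (M1 : manifold R n1) (M2 : manifold R n2) :
    manifold R (n1 + n2) :=
  @Manifold R (n1 + n2) (M1 * M2)%type (index M1 * index M2)%type
    (fun i => prod_chart (chart_at i.1) (chart_at i.2))
    (prod_hausdorff (@manifold_hausdorff _ _ M1) (@manifold_hausdorff _ _ M2))
    (prod_second_countable (@manifold_second_countable _ _ M1)
                           (@manifold_second_countable _ _ M2))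
    (fun i => prod_is_chart (manifold_chart i.1) (manifold_chart i.2))
    (fun p => let: ex_intro i pi := manifold_cover p.1 in
              let: ex_intro j pj := manifold_cover p.2 in
              ex_intro _ (i, j) (conj pi pj))
    (fun i j => prod_smooth_compatible (@manifold_smooth _ _ M1 i.1 j.1)
                                       (@manifold_smooth _ _ M2 i.2 j.2)).

End ProductManifold.

Section TwistedProduct.
Context {R : realType} {n1 n2 : nat}.
Context {M1 : manifold R n1} {M2 : manifold R n2}.

(* In product charts the first n1 components of a tangent vector w of M1 x M2
   at (x, u) are those of y in T_x M1 and the last n2 those of v in T_u M2. *)
Definition twisted_val (f : M1 * M2 -> R)
    (F1 : tangent_fun M1) (F2 : tangent_fun M2)
    (i : index (prod_manifold M1 M2)) (p : prod_manifold M1 M2)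
    (w : 'rV[R]_(n1 + n2)) : R :=
  Num.sqrt (F1 i.1 p.1 (lsubmx w) ^+ 2 + f p ^+ 2 * F2 i.2 p.2 (rsubmx w) ^+ 2).

Lemma jacobi_prod (T1 T2 : topologicalType)
    (c1 d1 : chart R n1 T1) (c2 d2 : chart R n2 T2) (z : 'rV[R]_(n1 + n2)) :
  jacobi (transition (prod_chart c1 c2) (prod_chart d1 d2)) z
  = block_mx (jacobi (transition c1 d1) (lsubmx z)) 0
             0 (jacobi (transition c2 d2) (rsubmx z)).
Proof.
have lD (a : R) (u v : 'rV[R]_(n1 + n2)) :
  lsubmx (a *: u + v) = a *: lsubmx u + lsubmx v.
  by apply/rowP => j; rewrite !mxE.
have rD (a : R) (u v : 'rV[R]_(n1 + n2)) :
  rsubmx (a *: u + v) = a *: rsubmx u + rsubmx v.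
  by apply/rowP => j; rewrite !mxE.
have El k : (fun x => transition (prod_chart c1 c2) (prod_chart d1 d2) x 0
                        (lshift n2 k))
    = (fun x => transition c1 d1 x 0 k) \o lsubmx.
  by apply/funext => x; rewrite /transition /= row_mxEl.
have Er k : (fun x => transition (prod_chart c1 c2) (prod_chart d1 d2) x 0
                        (rshift n1 k))
    = (fun x => transition c2 d2 x 0 k) \o rsubmx.
  by apply/funext => x; rewrite /transition /= row_mxEr.
apply/matrixP => a b; case: (split_ordP a) => k ->; case: (split_ordP b) => l ->.
- by rewrite block_mxEul !mxE El /pd derive_pr // lsubmx_delta_l.
- by rewrite block_mxEur !mxE Er /pd derive_pr // rsubmx_delta_l derive0.
- by rewrite block_mxEdl !mxE El /pd derive_pr // lsubmx_delta_r derive0.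
- by rewrite block_mxEdr !mxE Er /pd derive_pr // rsubmx_delta_r.
Qed.

Lemma twisted_val_compat f F1 F2 (i j : index (prod_manifold M1 M2))
    (p : prod_manifold M1 M2) (w : 'rV[R]_(n1 + n2)) :
  dom (chart_at i) p -> dom (chart_at j) p ->
  twisted_val f F1 F2 j p
    (w *m jacobi (transition (chart_at i) (chart_at j)) (coord (chart_at i) p))
  = twisted_val f F1 F2 i p w.
Proof.
case: p => p q [/= ip iq] [/= jp jq].
rewrite /twisted_val /= jacobi_prod row_mxKl row_mxKr.
rewrite -[w in w *m _]hsubmxK mul_row_block !mulmx0 addr0 add0r.
by rewrite row_mxKl row_mxKr !tangent_val_compat.
Qed.

Definition twisted_product (f : M1 * M2 -> R)
    (F1 : tangent_fun M1) (F2 : tangent_fun M2) :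
    tangent_fun (prod_manifold M1 M2) :=
  TangentFun (@twisted_val_compat f F1 F2).

Definition twisted_domain (i : index (prod_manifold M1 M2))
    (p : prod_manifold M1 M2) : set 'rV[R]_(n1 + n2) :=
  [set w | lsubmx w != 0 /\ rsubmx w != 0].

End TwistedProduct.

(* Main.v *)
(* The isotropy factor c(p) is killed by the single mixed component
   B^a_{akk}, with a an index of the second factor and k one of the first.
   The energy F^2 = F1^2(x, y) + f^2(x, u) F2^2(u, v) splits, so the fundamental
   tensor is block diagonal and the components G^a of the spray are affine in y;
   hence B^a_{akk} = 0.  On the other hand, for y = s e_k and v = t e_a with
   s, t > 0, homogeneity gives F = sqrt(A s^2 + B t^2) with A, B > 0, and the
   same component of the isotropic tensor is
   F_kk + F_kka v^a = 3 A^2 B s^2 t^2 / F^5 <> 0.  Restricting to the plane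
   spanned by e_k and e_a makes all derivatives one-dimensional. *)
Require Import Defs.
From HB Require Import structures.
From mathcomp Require Import all_boot all_order all_algebra.
From mathcomp Require Import all_classical all_reals all_analysis.
From mathcomp Require Import ring.

Set Implicit Arguments.
Unset Strict Implicit.
Unset Printing Implicit Defensive.

Import Order.TTheory GRing.Theory Num.Theory.
Import numFieldNormedType.Exports.

Local Open Scope classical_set_scope.
Local Open Scope ring_scope.

(** * Directional derivatives as one-variable derivatives, and derivatives of square roots *)

Section Derivatives.
Context {R : realType}.

(** Both sides are limits of the same difference quotient, so no differentiability has to be
    established before passing to one variable. *)
Lemma derive_line (V : normedModType R) (h : V -> R) (v x : V) (s : R) :
  'D_v h (s *: v + x) = derive1 (fun t => h (t *: v + x)) s.
Proof.
rewrite /derive /derive1.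
rewrite (_ : (fun e : R => _) =
  (fun e : R => e^-1 *: (h ((e + s) *: v + x) - h (s *: v + x))))//.
by apply/funext => e /=; rewrite scalerDl addrA.
Qed.

(** The term [h] cancels inside the difference quotient, so the identity holds even where [g] is not
    derivable. *)
Lemma derive_addl_cst (V : normedModType R) (h g : V -> R) (v x : V) :
  (forall e : R, h (e *: v + x) = h x) -> 'D_v (h + g) x = 'D_v g x.
Proof.
move=> hx; rewrite /derive.
rewrite (_ : (fun e : R => _) =
  (fun e : R => e^-1 *: ((g \o shift x) (e *: v) - g x)))//.
by apply/funext => e /=; rewrite !fctE hx opprD addrACA subrr add0r.
Qed.

(** A derivative at [s] sees only nearby, hence positive, arguments. Positive homogeneity gives
    closed formulas on open rays only, and this is how they get differentiated. *)
Lemma derive1_eq_pos (f g : R -> R) (s : R) :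
  0 < s -> (forall t, 0 < t -> f t = g t) -> derive1 f s = derive1 g s.
Proof.
move=> s0 fg; rewrite !derive1E; apply: near_eq_derive.
by near=> t; apply: fg; near: t; exact: lt_nbhsr.
Unshelve. all: by end_near. Qed.

Lemma derive1_affine (a b s : R) : derive1 (fun t : R => a + t * b) s = b.
Proof.
have -> : (fun t : R => a + t * b) = cst a + b \*: (@id R).
  by apply/funext => t; rewrite mulrC.
rewrite derive1E; have /@derive_val -> := is_deriveD (is_derive_cst a s 1)
  (is_deriveZ b (is_derive_id s 1)).
by rewrite add0r; exact: mulr1.
Qed.

Lemma is_derive_square (a b s : R) :
  is_derive s 1 (fun t : R => a * t ^+ 2 + b) (2 * a * s).
Proof.
have -> : (fun t : R => a * t ^+ 2 + b) = (a \*: (id ^+ 2)) + cst b by [].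
by apply: is_derive_eq; rewrite /GRing.scale /= expr1 mulr1 addr0 mulrCA mulrA.
Qed.

Lemma is_derive_sqrt_square (a b s : R) : 0 < a * s ^+ 2 + b ->
  is_derive s 1 (fun t : R => Num.sqrt (a * t ^+ 2 + b))
    (a * s / Num.sqrt (a * s ^+ 2 + b)).
Proof.
move=> p; have r0 : Num.sqrt (a * s ^+ 2 + b) != 0 by rewrite gt_eqF ?sqrtr_gt0.
have := @is_derive1_comp _ (@Num.sqrt R) _ s _ _
  (is_derive1_sqrt p) (is_derive_square a b s).
by move=> /is_derive_eq; apply; field.
Qed.

Lemma derive1_sqrt_square (a b s : R) : 0 < a * s ^+ 2 + b ->
  derive1 (fun t : R => Num.sqrt (a * t ^+ 2 + b)) s
  = a * s / Num.sqrt (a * s ^+ 2 + b).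
Proof. by move=> p; rewrite derive1E; have /@derive_val := is_derive_sqrt_square p. Qed.

Lemma derive1_sqrt_square2 (a b s : R) : 0 < a * s ^+ 2 + b ->
  derive1 (fun t : R => a * t / Num.sqrt (a * t ^+ 2 + b)) s
  = a * b / Num.sqrt (a * s ^+ 2 + b) ^+ 3.
Proof.
move=> p; rewrite derive1E.
have r0 : Num.sqrt (a * s ^+ 2 + b) != 0 by rewrite gt_eqF ?sqrtr_gt0.
have dr := is_derive_sqrt_square p.
have dV := @is_deriveV _ (fun t => Num.sqrt (a * t ^+ 2 + b)) _ _ _ r0 dr.
have e : (fun t : R => a * t / Num.sqrt (a * t ^+ 2 + b))
   = (a \*: id) * (fun t => (Num.sqrt (a * t ^+ 2 + b))^-1) by [].
rewrite e derive_val /= /GRing.scale /= mulr1.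
have r2 := sqr_sqrtr (ltW p); set r := Num.sqrt _ in r0 r2 *.
(* Eliminating [b] through the square of the root leaves a rational identity in [a], [s] and [r]. *)
have -> : b = r ^+ 2 - a * s ^+ 2 by rewrite r2 addrAC subrr add0r.
by field.
Qed.

(** The quotient is the shape of [F_kk] as a function of the second plane coordinate: there [a] is
    B, [b] is A s^2 and [c] is A B. *)
Lemma derive1_sqrt_square3 (a b c s : R) : 0 < a * s ^+ 2 + b ->
  derive1 (fun t : R => c * t ^+ 2 / Num.sqrt (a * t ^+ 2 + b) ^+ 3) s
  = c * s * (2 * b - a * s ^+ 2) / Num.sqrt (a * s ^+ 2 + b) ^+ 5.
Proof.
move=> p; rewrite derive1E.
have r0 : Num.sqrt (a * s ^+ 2 + b) != 0 by rewrite gt_eqF ?sqrtr_gt0.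
have dr := is_derive_sqrt_square p.
have dV := @is_deriveV _ (fun t => Num.sqrt (a * t ^+ 2 + b)) _ _ _ r0 dr.
have e : (fun t : R => c * t ^+ 2 / Num.sqrt (a * t ^+ 2 + b) ^+ 3)
   = (c \*: (id ^+ 2)) * (fun t => (Num.sqrt (a * t ^+ 2 + b))^-1) ^+ 3.
  by apply/funext => t; rewrite !fctE /= -exprVn.
rewrite e derive_val /= !fctE /GRing.scale /= mulr1.
have r2 := sqr_sqrtr (ltW p); set r := Num.sqrt _ in r0 r2 *.
have -> : b = r ^+ 2 - a * s ^+ 2 by rewrite r2 addrAC subrr add0r.
by field.
Qed.

End Derivatives.

(** * Invertibility and block inverses *)

Section LinearAlgebra.

(** A nonzero [w] with [w *m A = 0] would make the quadratic form vanish at [w]. *)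
Lemma posdef_unitmx (R : realFieldType) n (A : 'M[R]_n) :
  (forall w : 'rV[R]_n, w != 0 ->
     0 < \sum_(j < n) \sum_(k < n) A j k * w 0 j * w 0 k) -> A \in unitmx.
Proof.
move=> Apos; rewrite -row_free_unit -kermx_eq0; apply/negPn/negP.
move=> /rowV0Pn[w /sub_kermxP wA w0]; have := Apos w w0.
rewrite exchange_big /= big1 ?ltxx// => k _; rewrite -mulr_suml.
have /rowP/(_ k) := wA; rewrite !mxE => wAk.
by under eq_bigr do rewrite mulrC; rewrite wAk mul0r.
Qed.

(* When [D] is singular, both sides are given by [invmx M = M]. *)
Lemma dsubmx_invmx_block_diag (R : comUnitRingType) n1 n2
    (A : 'M[R]_n1) (D : 'M[R]_n2) : A \in unitmx ->
  dsubmx (invmx (block_mx A 0 0 D)) = row_mx 0 (invmx D).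
Proof.
move=> Au; have [Du|Dn] := boolP (D \in unitmx).
  by rewrite invmx_block_diag ?block_diag_mx_unit ?Au// block_mxEv col_mxKd.
rewrite /invmx block_diag_mx_unit Au/= (negbTE Dn).
by rewrite block_mxEv col_mxKd.
Qed.

End LinearAlgebra.

(** * Partial derivatives of functions of one block of coordinates *)

Section Blocks.
Context {R : realType} {n1 n2 : nat}.

Let lsubmxP (a : R) (u v : 'rV[R]_(n1 + n2)) :
  lsubmx (a *: u + v) = a *: lsubmx u + lsubmx v.
Proof. by apply/rowP => j; rewrite !mxE. Qed.

Let rsubmxP (a : R) (u v : 'rV[R]_(n1 + n2)) :
  rsubmx (a *: u + v) = a *: rsubmx u + rsubmx v.
Proof. by apply/rowP => j; rewrite !mxE. Qed.

Lemma pd_lshift_lsubmx (k : 'I_n1) (h : 'rV[R]_n1 -> R) (w : 'rV[R]_(n1 + n2)) :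
  pd (lshift n2 k) (fun z => h (lsubmx z)) w = pd k h (lsubmx w).
Proof.
have := derive_pr lsubmxP h w (delta_mx 0 (lshift n2 k)).
by rewrite lsubmx_delta_l.
Qed.

Lemma pd_rshift_lsubmx (k : 'I_n2) (h : 'rV[R]_n1 -> R) (w : 'rV[R]_(n1 + n2)) :
  pd (rshift n1 k) (fun z => h (lsubmx z)) w = 0.
Proof.
have := derive_pr lsubmxP h w (delta_mx 0 (rshift n1 k)).
by rewrite lsubmx_delta_r derive0.
Qed.

Lemma pd_lshift_rsubmx (k : 'I_n1) (h : 'rV[R]_n2 -> R) (w : 'rV[R]_(n1 + n2)) :
  pd (lshift n2 k) (fun z => h (rsubmx z)) w = 0.
Proof.
have := derive_pr rsubmxP h w (delta_mx 0 (lshift n2 k)).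
by rewrite rsubmx_delta_l derive0.
Qed.

Lemma pd_rshift_rsubmx (k : 'I_n2) (h : 'rV[R]_n2 -> R) (w : 'rV[R]_(n1 + n2)) :
  pd (rshift n1 k) (fun z => h (rsubmx z)) w = pd k h (rsubmx w).
Proof.
have := derive_pr rsubmxP h w (delta_mx 0 (rshift n1 k)).
by rewrite rsubmx_delta_r.
Qed.

Lemma pd_lshift_addr (k : 'I_n1) (g : 'rV[R]_(n1 + n2) -> R)
    (h : 'rV[R]_n2 -> R) w :
  pd (lshift n2 k) (fun z => g z + h (rsubmx z)) w = pd (lshift n2 k) g w.
Proof.
rewrite (_ : (fun z => _) = (fun z => h (rsubmx z)) + g).
  by apply: derive_addl_cst => e; rewrite rsubmxP rsubmx_delta_l scaler0 add0r.
by apply/funext => z; exact: addrC.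
Qed.

Lemma pd_rshift_addl (k : 'I_n2) (g : 'rV[R]_(n1 + n2) -> R)
    (h : 'rV[R]_n1 -> R) w :
  pd (rshift n1 k) (fun z => h (lsubmx z) + g z) w = pd (rshift n1 k) g w.
Proof.
rewrite (_ : (fun z => _) = (fun z => h (lsubmx z)) + g)//.
by apply: derive_addl_cst => e; rewrite lsubmxP lsubmx_delta_r scaler0 add0r.
Qed.

End Blocks.

(** * Fundamental tensor and spray of a split energy *)

Section SplitEnergy.
Context {R : realType} {n1 n2 : nat}.
Variables (L : 'rV[R]_(n1 + n2) -> 'rV[R]_(n1 + n2) -> R).
Variables (L1 : 'rV[R]_n1 -> 'rV[R]_n1 -> R).
(** The base point of [E2] is the full one because the twisting function depends on both factors;
    its fibre argument is the second block alone. *)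
Variables (E2 : 'rV[R]_(n1 + n2) -> 'rV[R]_n2 -> R).
Hypothesis energyE : forall x w,
  energy L x w = energy L1 (lsubmx x) (lsubmx w) + E2 x (rsubmx w).

Lemma pd_energy_lshift x (k : 'I_n1) :
  pd (lshift n2 k) (energy L x)
  = fun w => pd k (energy L1 (lsubmx x)) (lsubmx w).
Proof.
apply/funext => w; rewrite (funext (energyE x)).
rewrite (pd_lshift_addr _ (fun z => energy L1 (lsubmx x) (lsubmx z))).
exact: pd_lshift_lsubmx.
Qed.

Lemma pd_energy_rshift x (k : 'I_n2) :
  pd (rshift n1 k) (energy L x) = fun w => pd k (E2 x) (rsubmx w).
Proof.
apply/funext => w; rewrite (funext (energyE x)).
rewrite (pd_rshift_addl _ (fun z => E2 x (rsubmx z))).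
exact: pd_rshift_rsubmx.
Qed.

Lemma fundamental_tensor_split x w :
  fundamental_tensor L x w =
  block_mx (fundamental_tensor L1 (lsubmx x) (lsubmx w)) 0
           0 (\matrix_(a, b) (2^-1 * pd a (pd b (E2 x)) (rsubmx w))).
Proof.
apply/matrixP => a b; case: (split_ordP a) => k ->; case: (split_ordP b) => l ->.
- by rewrite block_mxEul !mxE pd_energy_lshift pd_lshift_lsubmx.
- by rewrite block_mxEur !mxE pd_energy_rshift pd_lshift_rsubmx mulr0.
- by rewrite block_mxEdl !mxE pd_energy_lshift pd_rshift_lsubmx mulr0.
- by rewrite block_mxEdr !mxE pd_energy_rshift pd_rshift_rsubmx.
Qed.

(* The first components of the tangent vector enter only through the transport
   term [y^k d/dx^k] of the spray. *)
Lemma spray_rshift_affine x (a : 'I_n2) :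
  exists (C : 'rV[R]_n2 -> R) (q : 'I_n1 -> 'rV[R]_n2 -> R),
  forall w, fundamental_tensor L1 (lsubmx x) (lsubmx w) \in unitmx ->
  spray L x w (rshift n1 a)
  = C (rsubmx w) + \sum_(k < n1) lsubmx w 0 k * q k (rsubmx w).
Proof.
pose g v : 'M[R]_n2 := \matrix_(a, b) (2^-1 * pd a (pd b (E2 x)) v).
pose D v j l := pd j (fun x' => pd l (E2 x') v) x.
(* [C] collects the transport terms of the second block and the position derivative, [q k] is the
   coefficient of [y^k]. Both depend on [v] only, so one choice serves all [w]. *)
exists (fun v => 4^-1 * \sum_l invmx (g v) a l *
  (\sum_b D v (rshift n1 b) l * v 0 b - pd (rshift n1 l) (fun x' => E2 x' v) x)).
exists (fun k v => 4^-1 * \sum_l invmx (g v) a l * D v (lshift n2 k) l).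
move=> w gu.
have invE b : invmx (fundamental_tensor L x w) (rshift n1 a) b
    = row_mx 0 (invmx (g (rsubmx w))) a b.
  by rewrite -(dsubmx_invmx_block_diag _ gu) fundamental_tensor_split mxE.
(* Row [a] of the inverse vanishes on the first block, which removes that half of the sum over
   [l]. *)
rewrite /spray big_split_ord /= big1 => [|l _]; last first.
  by rewrite invE row_mxEl mxE mul0r.
under [X in _ = _ + X]eq_bigr do rewrite mulrCA.
rewrite add0r -mulr_sumr -mulrDr; congr (_ * _).
under [X in _ = _ + X]eq_bigr do rewrite mulr_sumr.
rewrite exchange_big /= -big_split /=; apply: eq_bigr => l _.
rewrite invE row_mxEr.
under [X in _ = _ + X]eq_bigr do rewrite mulrCA.
rewrite -mulr_sumr -mulrDr; congr (_ * _).
rewrite addrAC; congr (_ - _).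
  have DE : (fun x' => pd (rshift n1 l) (energy L x') w)
      = (fun x' => pd l (E2 x') (rsubmx w)).
    by apply/funext => x'; rewrite pd_energy_rshift.
  rewrite big_split_ord /= addrC DE; congr (_ + _); apply: eq_bigr => k _.
    by rewrite [rsubmx w 0 k]mxE.
  by rewrite mulrC [lsubmx w 0 k]mxE.
(* The energy of [L1] does not vary with the base point of the second factor, so only [E2]
   contributes. *)
rewrite (funext (energyE^~ w)).
exact: (pd_rshift_addl _ (fun z => E2 z (rsubmx w))
  (fun z => energy L1 z (lsubmx w))).
Qed.

End SplitEnergy.

(** Indices of different blocks never agree, so of the three Kronecker deltas only the one pairing
    the two copies of [a] survives. *)
Lemma isotropic_berwald_tensor_block (R : realType) n1 n2
    (L : 'rV[R]_(n1 + n2) -> 'rV[R]_(n1 + n2) -> R) x w (k : 'I_n1) (a : 'I_n2) :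
  isotropic_berwald_tensor L x w
    (rshift n1 a) (rshift n1 a) (lshift n2 k) (lshift n2 k)
  = pd (lshift n2 k) (pd (lshift n2 k) (L x)) w
    + pd (rshift n1 a) (pd (lshift n2 k) (pd (lshift n2 k) (L x))) w
      * w 0 (rshift n1 a).
Proof.
have simpl3 (b c d e : R) : b * false%:R + c * true%:R + d * false%:R + e = c + e.
  by rewrite !mulr0 mulr1 add0r addr0.
by rewrite /isotropic_berwald_tensor eq_rlshift eqxx; exact: simpl3.
Qed.

Lemma delta_row_neq0 (R : realType) n (k : 'I_n) :
  delta_mx 0 k != 0 :> 'rV[R]_n.
Proof.
by apply/eqP => /rowP/(_ k); rewrite !mxE !eqxx => /eqP; rewrite oner_eq0.
Qed.

(** By homogeneity the energy on the ray through [e] is [a * t ^+ 2] with [a] the square of F at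
    [e]; hence the diagonal entry of the fundamental tensor at [e] is [a], and positive definiteness
    makes it positive. *)
Lemma finsler_delta_gt0 (R : realType) n (M : manifold R n) (F : tangent_fun M)
    (i : Defs.index M) (p : M) (k : 'I_n) :
  finsler F -> dom (chart_at i) p -> 0 < F i p (delta_mx 0 k).
Proof.
move=> FF ip; rewrite lt_neqAle finsler_ge0// andbT eq_sym.
set e : 'rV[R]_n := delta_mx 0 k; pose a := F i p e ^+ 2.
suff : 0 < a by rewrite /a; apply: contraTneq => ->; rewrite expr0n ltxx.
have cp : codom_chart (chart_at i) (Defs.coord (chart_at i) p) by exists p.
have := finsler_posdef FF cp (delta_row_neq0 R k) (delta_row_neq0 R k).
rewrite (bigD1 k)//= [X in _ + X]big1 ?addr0 => [|j jk]; last first.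
  by rewrite big1// => l _; rewrite [X in _ * X * _]mxE (negbTE jk) mulr0 mul0r.
rewrite (bigD1 k)//= [X in _ + X]big1 ?addr0 => [|j jk]; last first.
  by rewrite [X in _ * X]mxE (negbTE jk) mulr0.
rewrite !mxE !eqxx !mulr1 -/e.
have E t : 0 < t -> energy (local_expr F i) (Defs.coord (chart_at i) p) (t *: e + 0)
    = a * t ^+ 2 + 0.
  move=> t0; rewrite /energy /local_expr coordK//; last exact: manifold_chart.
  by rewrite !addr0 finsler_homog// exprMn mulrC.
have D1 t : 0 < t -> pd k (energy (local_expr F i) (Defs.coord (chart_at i) p))
    (t *: e + 0) = 0 + t * (2 * a).
  move=> t0; rewrite /pd derive_line (derive1_eq_pos t0 E) derive1E.
  by have /@derive_val -> := is_derive_square a 0 t; rewrite add0r mulrC.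
(* [e] becomes [1 *: e + 0], the point of parameter 1 on the ray. *)
rewrite -[X in pd k (pd k _) X]addr0 -[X in X + 0]scale1r.
rewrite {1}/pd derive_line (derive1_eq_pos ltr01 D1) derive1_affine.
by rewrite mulKf// pnatr_eq0.
Qed.

(** * The mixed component on the plane spanned by [el] and [er] *)

Section Twisted.
Context {R : realType} {n1 n2 : nat}.
Context {M1 : manifold R n1} {M2 : manifold R n2}.
Variables (F1 : tangent_fun M1) (F2 : tangent_fun M2).
Variable f : prod_manifold M1 M2 -> R.
Hypotheses (FF1 : finsler F1) (FF2 : finsler F2) (f_gt0 : forall p, 0 < f p).
Variables (i : Defs.index (prod_manifold M1 M2)) (p : prod_manifold M1 M2).
Hypothesis ip : dom (chart_at i) p.
Variables (k : 'I_n1) (a : 'I_n2).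

Let L := local_expr (twisted_product f F1 F2) i.
Let x := Defs.coord (chart_at i) p.
Let el : 'rV[R]_(n1 + n2) := delta_mx 0 (lshift n2 k).
Let er : 'rV[R]_(n1 + n2) := delta_mx 0 (rshift n1 a).
Let A := F1 i.1 p.1 (delta_mx 0 k) ^+ 2.
Let B := f p ^+ 2 * F2 i.2 p.2 (delta_mx 0 a) ^+ 2.

Let A_gt0 : 0 < A.
Proof. by case: ip => ? ?; rewrite exprn_gt0// finsler_delta_gt0. Qed.

Let B_gt0 : 0 < B.
Proof.
by case: ip => ? ?; rewrite mulr_gt0// exprn_gt0// finsler_delta_gt0.
Qed.

Let lsub_plane (s t : R) : lsubmx (s *: el + t *: er) = s *: delta_mx 0 k.
Proof.
by rewrite linearD !linearZ /= lsubmx_delta_l lsubmx_delta_r scaler0 addr0.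
Qed.

Let rsub_plane (s t : R) : rsubmx (s *: el + t *: er) = t *: delta_mx 0 a.
Proof.
by rewrite linearD !linearZ /= rsubmx_delta_l rsubmx_delta_r scaler0 add0r.
Qed.

Let plane_pd_l (h : 'rV[R]_(n1 + n2) -> R) (s t : R) :
  pd (lshift n2 k) h (s *: el + t *: er)
  = derive1 (fun s' => h (s' *: el + t *: er)) s.
Proof. by rewrite /pd derive_line. Qed.

Let plane_pd_r (h : 'rV[R]_(n1 + n2) -> R) (s t : R) :
  pd (rshift n1 a) h (s *: el + t *: er)
  = derive1 (fun t' => h (s *: el + t' *: er)) t.
Proof.
under eq_fun do rewrite addrC.
by rewrite /pd addrC derive_line.
Qed.

Let E2 (z : 'rV[R]_(n1 + n2)) (v : 'rV[R]_n2) : R :=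
  f (param (chart_at i) z) ^+ 2 * F2 i.2 (param (chart_at i) z).2 v ^+ 2.

Let twisted_energyE z w : energy L z w =
  energy (local_expr F1 i.1) (lsubmx z) (lsubmx w) + E2 z (rsubmx w).
Proof.
rewrite /energy sqr_sqrtr//.
by apply: addr_ge0; [|apply: mulr_ge0]; exact: sqr_ge0.
Qed.

Lemma twisted_berwald_curvature_plane (s t : R) : 0 < s ->
  berwald_curvature L x (s *: el + t *: er)
    (rshift n1 a) (rshift n1 a) (lshift n2 k) (lshift n2 k) = 0.
Proof.
move=> s0; have [C [q G]] := spray_rshift_affine (E2 := E2) twisted_energyE x a.
have G1 (s' t' : R) : 0 < s' -> spray L x (s' *: el + t' *: er) (rshift n1 a)
    = C (t' *: delta_mx 0 a) + s' * q k (t' *: delta_mx 0 a).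
  move=> s'0; rewrite G ?lsub_plane ?rsub_plane.
    congr (_ + _); rewrite (bigD1 k)//= big1 ?addr0 => [|j jk].
      by rewrite !mxE !eqxx mulr1.
    by rewrite !mxE (negbTE jk) mulr0 mul0r.
  apply: posdef_unitmx => w w0; apply: finsler_posdef => //.
    by case: ip => ip1 _; rewrite /x /= row_mxKl; exists p.1.
  by rewrite scaler_eq0 negb_or gt_eqF// delta_row_neq0.
(* The summand [s' * 0] presents this constant as an affine function, ready for the next
   derivative. *)
have G2 (s' t' : R) : 0 < s' ->
    pd (lshift n2 k) (fun w => spray L x w (rshift n1 a)) (s' *: el + t' *: er)
    = q k (t' *: delta_mx 0 a) + s' * 0.
  move=> s'0; rewrite plane_pd_l (derive1_eq_pos s'0 (fun u => @G1 u t')).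
  by rewrite derive1_affine mulr0 addr0.
rewrite /berwald_curvature plane_pd_r.
(* With [s] fixed, the second derivative in the first coordinate is zero for every real [t'], so the
   outer derivative is that of a constant function. *)
rewrite (_ : (fun t' => _) = cst 0) ?derive1_cst//.
apply/funext => t'; rewrite plane_pd_l.
by rewrite (derive1_eq_pos s0 (fun u => @G2 u t')) derive1_affine.
Qed.

Lemma twisted_isotropic_tensor_plane (s t : R) : 0 < s -> 0 < t ->
  isotropic_berwald_tensor L x (s *: el + t *: er)
    (rshift n1 a) (rshift n1 a) (lshift n2 k) (lshift n2 k)
  = 3 * A ^+ 2 * B * s ^+ 2 * t ^+ 2 / Num.sqrt (A * s ^+ 2 + B * t ^+ 2) ^+ 5.
Proof.
move=> s0 t0.
have pos (s' t' : R) : 0 < s' -> 0 < t' -> 0 < A * s' ^+ 2 + B * t' ^+ 2.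
  by move=> ? ?; rewrite addr_gt0// mulr_gt0// exprn_gt0.
have L0 (s' t' : R) : 0 < s' -> 0 < t' ->
    L x (s' *: el + t' *: er) = Num.sqrt (A * s' ^+ 2 + B * t' ^+ 2).
  move=> s'0 t'0; rewrite /L /local_expr /x coordK//; last exact: manifold_chart.
  case: ip => ip1 ip2; rewrite /= /twisted_val lsub_plane rsub_plane.
  rewrite !finsler_homog// !exprMn; congr Num.sqrt; rewrite /A /B; ring.
have L1 (s' t' : R) : 0 < t' -> 0 < s' ->
    pd (lshift n2 k) (L x) (s' *: el + t' *: er)
    = A * s' / Num.sqrt (A * s' ^+ 2 + B * t' ^+ 2).
  move=> t'0 s'0.
  rewrite plane_pd_l (derive1_eq_pos s'0 (fun u u0 => L0 u t' u0 t'0)).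
  by rewrite derive1_sqrt_square// pos.
have L2 (s' t' : R) : 0 < s' -> 0 < t' ->
    pd (lshift n2 k) (pd (lshift n2 k) (L x)) (s' *: el + t' *: er)
    = A * (B * t' ^+ 2) / Num.sqrt (A * s' ^+ 2 + B * t' ^+ 2) ^+ 3.
  move=> s'0 t'0.
  rewrite plane_pd_l (derive1_eq_pos s'0 (fun u => L1 u t' t'0)).
  by rewrite derive1_sqrt_square2// pos.
have L3 : pd (rshift n1 a) (pd (lshift n2 k) (pd (lshift n2 k) (L x)))
    (s *: el + t *: er) = A * B * t * (2 * (A * s ^+ 2) - B * t ^+ 2)
      / Num.sqrt (A * s ^+ 2 + B * t ^+ 2) ^+ 5.
  rewrite plane_pd_r (derive1_eq_pos t0 (fun u => L2 s u s0)).
  under eq_fun do rewrite mulrA [A * s ^+ 2 + _]addrC.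
  have p' : 0 < B * t ^+ 2 + A * s ^+ 2 by rewrite addrC pos.
  by rewrite derive1_sqrt_square3// [B * t ^+ 2 + _]addrC.
have tE : (s *: el + t *: er) 0 (rshift n1 a) = t.
  by rewrite !mxE eq_rshift eq_rlshift !eqxx mulr0 add0r mulr1.
rewrite isotropic_berwald_tensor_block L2// L3 tE.
have r2 := sqr_sqrtr (ltW (pos s t s0 t0)).
have : Num.sqrt (A * s ^+ 2 + B * t ^+ 2) != 0 by rewrite gt_eqF ?sqrtr_gt0 ?pos.
set r := Num.sqrt _ in r2 * => r0.
(* Expanding by r^2 = A s^2 + B t^2 gives both terms the denominator r^5; the B t^2 parts then
   cancel and 3 A s^2 remains. *)
have -> : A * (B * t ^+ 2) / r ^+ 3
    = A * (B * t ^+ 2) * (A * s ^+ 2 + B * t ^+ 2) / r ^+ 5 by rewrite -r2; field.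
by field.
Qed.

End Twisted.

(** * Vanishing of the isotropy factor *)

Theorem theorem8 (R : realType) (n1 n2 : nat)
    (M1 : manifold R n1) (M2 : manifold R n2)
    (F1 : tangent_fun M1) (F2 : tangent_fun M2)
    (f : prod_manifold M1 M2 -> R) :
  finsler F1 -> finsler F2 ->
  (forall p, 0 < f p) -> smooth_fun f ->
  isotropic_berwald twisted_domain (twisted_product f F1 F2) ->
  berwald twisted_domain (twisted_product f F1 F2).
Proof.
move=> FF1 FF2 f_gt0 _ [c isoB] i p w ip wA a j k l.
(* Nonzero [y] and [v] have nonzero coordinates, which supplies an index in each factor. *)
rewrite isoB//; case: wA => /rV0Pn[k0 _] /rV0Pn[a0 _].
suff -> : c p = 0 by rewrite mul0r.
(* The factor [c p] is shared by all vectors at [p], so it may be tested on [w0] instead of [w]. *)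
pose w0 : 'rV[R]_(n1 + n2) :=
  1 *: delta_mx 0 (lshift n2 k0) + 1 *: delta_mx 0 (rshift n1 a0).
have w0A : twisted_domain i p w0.
  rewrite /twisted_domain /w0 /= !scale1r !linearD /=.
  rewrite lsubmx_delta_l lsubmx_delta_r rsubmx_delta_l rsubmx_delta_r.
  by rewrite addr0 add0r !delta_row_neq0.
have := isoB i p w0 ip w0A
  (rshift n1 a0) (rshift n1 a0) (lshift n2 k0) (lshift n2 k0).
rewrite (twisted_berwald_curvature_plane F2 f FF1 ip k0 a0 1 ltr01).
rewrite (twisted_isotropic_tensor_plane FF1 FF2 f_gt0 ip k0 a0 ltr01 ltr01).
move=> /esym/eqP; rewrite mulf_eq0 => /orP[/eqP//|/eqP T0]; exfalso.
move: T0; apply/eqP; case: (ip) => ip1 ip2.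
have F1_gt0 := finsler_delta_gt0 k0 FF1 ip1.
have F2_gt0 := finsler_delta_gt0 a0 FF2 ip2.
by rewrite gt_eqF// divr_gt0 ?exprn_gt0 ?sqrtr_gt0 ?addr_gt0
  ?mulr_gt0 ?exprn_gt0.
Qed.
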